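(* Let $\beta>1$, $\gamma>0$ and $\top>0$. There exist constants $c_1,c_2,c_3>0$, depending only on $\beta,\gamma,\top$, such that the following holds. Let $X$ be a random variable with $\mathbb{E}[\exp(\gamma|X|^\beta)]<\top<\infty$, let $K>0$, and let $\phi:[0,1]\to[0,K]$ be a (measurable) risk spectrum. Then, for every $\epsilon>0$ and $n\ge1$, $$\mathbb{P}\left(|m_{n,\phi}-M_\phi(X)|>\epsilon\right)\le c_1\left[\exp\left(-c_2n\left(\tfrac{\epsilon}{K}\right)^2\right)\mathbf 1\{\epsilon\le K\}+\exp\left(-c_3n\left(\tfrac{\epsilon}{K}\right)^\beta\right)\mathbf 1\{\epsilon>K\}\right].$$
   Context: For a CDF $F$ on $\mathbb{R}$, $F^{-1}(u)=\inf\{x\in\mathbb{R}:F(x)\ge u\}$. The spectral risk measure with risk spectrum (weighting function) $\phi$ is $M_\phi(X)=\int_0^1\phi(u)F_X^{-1}(u)\,du$, where $F_X$ is the CDF of $X$. Given i.i.d. samples $X_1,\dots,X_n$ from the distribution of $X$ with empirical distribution function $F_n(x)=\frac1n\sum_{i=1}^n\mathbf 1\{X_i\le x\}$, the empirical estimate is $m_{n,\phi}=\int_0^1\phi(u)F_n^{-1}(u)\,du$. *)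

(* Defs.v *)
From mathcomp Require Import all_boot all_order all_algebra.
From mathcomp Require Import all_classical all_reals all_analysis.

Set Implicit Arguments.
Unset Strict Implicit.
Unset Printing Implicit Defensive.

Import Order.TTheory GRing.Theory Num.Theory.
Import numFieldNormedType.Exports.

Local Open Scope classical_set_scope.
Local Open Scope ring_scope.
Local Open Scope ereal_scope.

(* Valued in [\bar R]: for a distribution function F, the infimum may be
   infinite at the endpoints u = 0 and u = 1, a Lebesgue-null set. *)
Definition quantile (R : realType) (F : R -> \bar R) (u : R) : \bar R :=
  ereal_inf [set x%:E | x in [set x : R | u%:E <= F x]].

Definition spectral_integral (R : realType) (phi : R -> R) (F : R -> \bar R)
    : \bar R :=
  \int[lebesgue_measure]_(u in `[0%R, 1%R]) ((phi u)%:E * quantile F u).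

Definition spectral_risk (R : realType) d (T : measurableType d)
    (P : probability T R) (phi : R -> R) (X : {RV P >-> R}) : \bar R :=
  spectral_integral phi (cdf X).

Definition empirical_cdf (R : realType) (n : nat) (x : 'I_n -> R) (t : R)
    : \bar R :=
  (n%:R^-1 * \sum_(i < n) (x i <= t)%R%:R)%R%:E.

Definition empirical_spectral_risk (R : realType) (n : nat) (phi : R -> R)
    (x : 'I_n -> R) : \bar R :=
  spectral_integral phi (empirical_cdf x).

Definition mutually_independent (R : realType) d (T : measurableType d)
    (P : probability T R) (n : nat) (Xs : 'I_n -> {RV P >-> R}) : Prop :=
  forall (J : {set 'I_n}) (A : 'I_n -> set R),
    (forall i, i \in J -> measurable (A i)) ->
    P (\bigcap_(i in [set` J]) (Xs i @^-1` A i)) =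
    \prod_(i in J) P (Xs i @^-1` A i).

Definition same_distribution (R : realType) d (T : measurableType d)
    (P : probability T R) d' (T' : measurableType d') (P' : probability T' R)
    (Y : {RV P >-> R}) (X : {RV P' >-> R}) : Prop :=
  forall A : set R, measurable A -> distribution P Y A = distribution P' X A.

Definition iid_sample (R : realType) d (T : measurableType d)
    (P : probability T R) d' (T' : measurableType d') (P' : probability T' R)
    (n : nat) (Xs : 'I_n -> {RV P >-> R}) (X : {RV P' >-> R}) : Prop :=
  mutually_independent Xs /\ forall i, same_distribution (Xs i) X.

(* Main.v *)
(* With W = \int |F_n - F| dx (the first Wasserstein distance), Tonelli and the
   Galois connection quantile F u <= x <-> u <= F x give
   |m_n - M_phi| <= K W, so it is enough to bound the deviations of W at
   delta = eps / K.

   For delta <= 1, let w(x) = (1 + |x|)^beta, which is chosen so that dx / w(x)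
   is a finite measure, of mass kappa.  By Jensen's inequality for that measure,
     E exp(lambda W) <= kappa^-1 \int E exp(lambda kappa w |F_n - F|) dx / w,
   and for each x the variable n F_n(x) is a sum of n independent Bernoulli
   variables of parameter p = F(x); hence, with t = lambda kappa w(x) / n,
     E exp(n t |F_n(x) - p|) <= 2 exp(n t^2 e^t p (1 - p)).
   As p (1 - p) <= top exp(- gamma |x|^beta), the factor w^2 e^t p (1 - p) is
   bounded in x as soon as lambda <= c n for a small enough constant c, and the
   choice lambda = eta n delta gives the Gaussian bound.

   For delta large, W <= n^-1 \sum |X_i| + O(1), and by convexity of |.|^beta
   a large mean forces \sum |X_i|^beta to be at least of order n delta^beta,
   which Markov's inequality makes exponentially unlikely.  In between, the
   bound at delta = 1 is enough. *)

Require Import Defs.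
From mathcomp Require Import all_boot all_order all_algebra.
From mathcomp Require Import all_classical all_reals all_analysis.
From mathcomp Require Import measurable_realfun.
From mathcomp Require Import ring lra.

Set Implicit Arguments.
Unset Strict Implicit.
Unset Printing Implicit Defensive.

Import Order.TTheory GRing.Theory Num.Theory.
Import numFieldNormedType.Exports.

Local Open Scope classical_set_scope.
Local Open Scope ring_scope.

(** * Elementary inequalities for exponentials and powers; the weight *)

Section exp_pow_inequalities.
Context {R : realType}.
Implicit Types (s t a b c p x beta gamma : R).

(** The bound [1 - s <= expR (- s)] gives [expR s - 1 <= s * expR s]. For [s >= 0] this is used
    twice; for [s < 0] it is combined with [1 + s <= expR s]. *)
Lemma expR_le_quadratic s : expR s <= 1 + s + s ^+ 2 * expR `|s|.
Proof.
have es : expR s - 1 <= s * expR s.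
  have h : (1 - s) * expR s <= 1.
    rewrite -[leRHS](expRxMexpNx_1 s) mulrC ler_wpM2l ?expR_ge0//.
    by rewrite expR_ge1Dx.
  lra.
have [s0|s0] := leP 0 s.
  rewrite ger0_norm//.
  have : s * expR s - s <= s ^+ 2 * expR s by rewrite expr2; nra.
  lra.
have e1 : 1 <= expR `|s| by rewrite -expR0 ler_expR.
have := expR_ge1Dx s; nra.
Qed.

Lemma expR_ge_tangent a b : expR b * (1 + a - b) <= expR a.
Proof.
have -> : expR a = expR b * expR (a - b) by rewrite -expRD addrC subrK.
by rewrite ler_wpM2l ?expR_ge0// -addrA expR_ge1Dx.
Qed.

(** Centring cancels the linear terms, and the quadratic ones add up to the variance. Keeping the
    factor [p * (1 - p)], where Hoeffding's lemma has a constant, lets the decay of the tails pay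
    for the weight later. *)
Lemma centered_bernoulli_mgf p t : 0 <= p <= 1 ->
  p * expR (t * (1 - p)) + (1 - p) * expR (t * (0 - p))
    <= 1 + t ^+ 2 * expR `|t| * (p * (1 - p)).
Proof.
move=> /andP[p0 p1].
have q0 : 0 <= 1 - p by rewrite subr_ge0.
have h c : `|c| <= 1 -> expR (t * c) <= 1 + t * c + (t * c) ^+ 2 * expR `|t|.
  move=> c1; apply: le_trans (expR_le_quadratic _) _.
  rewrite lerD2l ler_wpM2l ?sqr_ge0// ler_expR normrM.
  by rewrite ler_piMr.
have h1 := ler_wpM2l p0 (h (1 - p) _).
have h2 := ler_wpM2l q0 (h (0 - p) _).
apply: le_trans (lerD (h1 _) (h2 _)) _.
- by rewrite ger0_norm// gerBl.
- by rewrite sub0r normrN ger0_norm.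
by rewrite le_eqVlt; apply/orP; left; apply/eqP; ring.
Qed.

(** The tangent at [s] to the convex power function. After division by [beta] this is Young's
    inequality for [a] and s^(beta - 1), with conjugate exponents [beta] and [beta / (beta - 1)]. *)
Lemma powR_ge_tangent beta a s : 1 < beta -> 0 <= a -> 0 <= s ->
  beta * s `^ (beta - 1) * a - (beta - 1) * s `^ beta <= a `^ beta.
Proof.
move=> b1 a0 s0.
have bm0 : 0 < beta - 1 by rewrite subr_gt0.
have b0 : 0 < beta by apply: lt_trans b1.
have bn0 : beta != 0 by rewrite gt_eqF.
have bmn0 : beta - 1 != 0 by rewrite gt_eqF.
have := @conjugate_powR R a (s `^ (beta - 1)) beta (beta / (beta - 1)) a0
  (powR_ge0 _ _) b0 (divr_gt0 b0 bm0).
rewrite -powRrM.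
have -> : (beta - 1) * (beta / (beta - 1)) = beta by field.
move=> /(_ _)/wrap[|h]; first by rewrite invf_div; field.
have {h} := ler_wpM2l (ltW b0) h.
have -> : beta * (a `^ beta / beta + s `^ beta / (beta / (beta - 1))) =
  a `^ beta + (beta - 1) * s `^ beta by field; rewrite bmn0.
lra.
Qed.

Definition weight beta x := (1 + `|x|) `^ beta.

Lemma weight_ge1 beta x : 0 <= beta -> 1 <= weight beta x.
Proof.
by move=> b0; rewrite -(powRr0 (1 + `|x|)); apply: ler_powR => //; rewrite
    lerDl.
Qed.

Lemma weight_gt0 beta x : 0 < weight beta x.
Proof. by rewrite powR_gt0// ltr_pwDl. Qed.

Lemma weight_le beta x : 0 <= beta ->
  weight beta x <= 2 `^ beta * (1 + `|x| `^ beta).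
Proof.
move=> b0; have [x1|x1] := leP 1 `|x|.
  apply: (@le_trans _ _ ((2 * `|x|) `^ beta)).
    by apply: ge0_ler_powR => //; rewrite ?nnegrE ?addr_ge0 ?mulr_ge0//; lra.
  rewrite powRM// ler_wpM2l ?powR_ge0// lerDr//.
apply: (@le_trans _ _ (2 `^ beta)).
  by apply: ge0_ler_powR => //; rewrite ?nnegrE ?addr_ge0//; lra.
by rewrite ler_peMr ?powR_ge0// lerDl powR_ge0.
Qed.

(** The square of [y <= expR y] at [y = c * x / 2]. *)
Lemma sqr_le_expR c x : 0 < c -> 0 <= x -> x ^+ 2 <= 4 / c ^+ 2 * expR (c * x).
Proof.
move=> c0 x0.
have h : c * x / 2 <= expR (c * x / 2).
  by apply: le_trans (expR_ge1Dx _); rewrite lerDr.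
have cx0 : 0 <= c * x / 2 by rewrite divr_ge0// mulr_ge0// ltW.
have {h} : (c * x / 2) ^+ 2 <= expR (c * x).
  have -> : expR (c * x) = expR (c * x / 2) ^+ 2.
    by rewrite expr2 -expRD; congr expR; field.
  by rewrite ler_sqr ?nnegrE// expR_ge0.
have c2 : 0 < 4 / c ^+ 2 by rewrite divr_gt0// exprn_gt0.
move=> /(ler_wpM2l (ltW c2)); apply: le_trans.
by rewrite le_eqVlt; apply/orP; left; apply/eqP; field; rewrite gt_eqF.
Qed.

(* The power of the weight has to match the power in the moment assumption for
   exp(c0 * weight) to be absorbed by exp(gamma |x|^beta). *)
Lemma weight_exp_tail beta gamma top : 0 < beta -> 0 < gamma -> 0 < top ->
  exists c0 C0 : R, [/\ 0 < c0, 0 < C0 & forall x q,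
    q <= top * expR (- (gamma * `|x| `^ beta)) ->
    weight beta x ^+ 2 * expR (c0 * weight beta x) * q <= C0].
Proof.
move=> b0 g0 t0.
have p20 : 0 < (2 : R) `^ beta by rewrite powR_gt0.
(* By [weight_le], [c0 * weight] is at most half of gamma (1 + |x|^beta). Two factors exp(c0 weight)
   are thus affordable: the one in the statement and one that dominates the squared weight. *)
pose c0 := gamma / (2 * 2 `^ beta).
have c00 : 0 < c0 by rewrite divr_gt0// mulr_gt0.
exists c0, (4 / c0 ^+ 2 * expR gamma * top); split => //.
  by rewrite !mulr_gt0 ?expR_gt0// invr_gt0 exprn_gt0.
move=> x q qle.
set y := weight beta x.
have y0 : 0 <= y by rewrite ltW// weight_gt0.
apply: (@le_trans _ _ (y ^+ 2 * expR (c0 * y) *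
    (top * expR (- (gamma * `|x| `^ beta))))).
  by rewrite ler_wpM2l// mulr_ge0 ?expR_ge0// sqr_ge0.
have h : y ^+ 2 * expR (c0 * y) <=
    4 / c0 ^+ 2 * (expR gamma * expR (gamma * `|x| `^ beta)).
  apply: (@le_trans _ _ (4 / c0 ^+ 2 * expR (c0 * y) * expR (c0 * y))).
    by rewrite ler_wpM2r ?expR_ge0// sqr_le_expR.
  rewrite -mulrA ler_wpM2l ?divr_ge0 ?sqr_ge0// -!expRD ler_expR.
  have : c0 * y <= c0 * (2 `^ beta * (1 + `|x| `^ beta)).
    by rewrite ler_wpM2l ?(ltW c00)// weight_le// ltW.
  have -> : c0 * (2 `^ beta * (1 + `|x| `^ beta)) =
      (gamma + gamma * `|x| `^ beta) / 2.
    by rewrite /c0; field; rewrite gt_eqF.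
  lra.
apply: (@le_trans _ _ (4 / c0 ^+ 2 * (expR gamma * expR (gamma * `|x| `^ beta))
    *
    (top * expR (- (gamma * `|x| `^ beta))))).
  by rewrite ler_wpM2r// mulr_ge0 ?expR_ge0// ltW.
have := expRxMexpNx_1 (gamma * `|x| `^ beta).
set e1 := expR (gamma * `|x| `^ beta); set e2 := expR (- _) => h12.
have -> : 4 / c0 ^+ 2 * (expR gamma * e1) * (top * e2) =
  4 / c0 ^+ 2 * expR gamma * top * (e1 * e2) by ring.
by rewrite h12 mulr1.
Qed.

Lemma continuous_weight beta : continuous (weight beta).
Proof.
move=> x.
have x0 : 0 < 1 + `|x| by rewrite ltr_pwDl.
apply: (@continuous_comp _ _ _ (fun x : R => 1 + `|x|) (fun u => u `^ beta)).
  by apply: cvgD; [exact: cvg_cst|exact: norm_continuous].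
apply: differentiable_continuous; apply/derivable1_diffP.
by apply: derivable_powR; rewrite in_itv/= x0.
Qed.

(** The integrand is even, and on the half-line (1 + x)^(1 - beta) / (1 - beta) is an
    antiderivative, which vanishes at infinity because [beta > 1]. *)
Lemma integral_inv_weight beta : 1 < beta ->
  exists kappa : R, 0 < kappa /\
    (\int[lebesgue_measure]_x ((weight beta x)^-1)%:E = kappa%:E)%E.
Proof.
move=> b1.
have bm0 : 0 < beta - 1 by rewrite subr_gt0.
exists (2 * (beta - 1)^-1); split; first by rewrite mulr_gt0// invr_gt0.
have cw : continuous (fun x => (weight beta x)^-1).
  by move=> x; apply: cvgV; [rewrite gt_eqF// weight_gt0|exact:
      continuous_weight].
rewrite ge0_symfun_integralT//; last 2 first.
- by move=> x; rewrite invr_ge0 ltW// weight_gt0.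
- by move=> x /=; rewrite /weight normrN.
rewrite EFinM; congr (_ * _)%E.
pose F x := (1 - beta)^-1 * (1 + x) `^ (1 - beta).
have dF x : 0 <= x -> is_derive x 1 F ((1 + x) `^ (- beta)).
  move=> x0.
  have x10 : 0 < 1 + x by rewrite ltr_pwDl.
  have h1 : is_derive x 1 (fun x : R => 1 + x) 1.
    by rewrite -[X in is_derive _ _ _ X]add0r; apply: is_deriveD.
  have h2 := is_derive1_powR (1 - beta) x10.
  have := is_derive1_comp h2 h1.
  move=> h3.
  have h4 := is_deriveZ (1 - beta)^-1 h3.
  apply: is_derive_eq h4 _.
  rewrite /GRing.scale/= mulr1.
  have -> : 1 - beta - 1 = - beta by ring.
  by field; lra.
rewrite -set_itvcy.
rewrite (@ge0_continuous_FTC2y _ _ F 0 0).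
- by rewrite /F addr0 powR1 mulr1 sub0e -EFinN -invrN opprB.
- by move=> x _; rewrite invr_ge0 ltW// weight_gt0.
- exact: continuous_subspaceT.
- rewrite /F -[X in _ --> X](mulr0 (1 - beta)^-1).
  apply: cvgM; first exact: cvg_cst.
  apply: (@cvg_trans _ (expR (- ((beta - 1) * ln (1 + x))) @[x --> +oo])).
    apply: near_eq_cvg; near=> x.
    have x0 : 0 <= x by near: x; exact: nbhs_pinfty_ge.
    rewrite /powR gt_eqF ?ltr_pwDl//; congr expR; ring.
  apply: (@cvg_comp _ _ _ (fun x : R => (beta - 1) * ln (1 + x))
    (fun u : R => expR (- u)) _ +oo _ _ (@cvgr_expR R)).
  apply/cvgryPge => a; near=> x.
  have : expR (a / (beta - 1)) <= x by near: x; apply: nbhs_pinfty_ge.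
  move=> xa; have x0 : 0 < x by apply: lt_le_trans xa; exact: expR_gt0.
  rewrite -ler_pdivrMl// mulrC -ler_expR lnK ?posrE ?addr_gt0//.
  by apply: le_trans xa _; rewrite lerDr.
- by move=> x x0; have := dF x (ltW x0); case.
- apply: cvg_at_right_filter.
  apply: differentiable_continuous; apply/derivable1_diffP.
  by case: (dF 0 (lexx _)).
- move=> x; rewrite in_itv/= andbT => x0.
  rewrite derive1E; have := dF x (ltW x0) => /@derive_val ->.
  by rewrite powRN /weight ger0_norm// ltW.
Unshelve. all: by end_near. Qed.

End exp_pow_inequalities.

(** * Measurability of real-valued indicators of comparisons *)

Section bool_measurability.
Context {R : realType} d (T : measurableType d).

Lemma measurable_fun_natr_bool (b : T -> bool) :
  measurable_fun setT b -> measurable_fun setT (fun z => (b z)%:R : R).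
Proof.
move=> mb; have -> : (fun z => (b z)%:R) = (fun z => if b z then 1 else 0 : R).
  by apply/funext => z; case: (b z).
exact: measurable_fun_ifT.
Qed.

Lemma measurable_fun_natr_le (f g : T -> R) :
  measurable_fun setT f -> measurable_fun setT g ->
  measurable_fun setT (fun z => (f z <= g z)%R%:R : R).
Proof.
by move=> mf mg; apply: measurable_fun_natr_bool; exact: measurable_fun_ler.
Qed.

End bool_measurability.

(** * Product formula for independent variables *)

Section independence.
Context {R : realType} d (T : measurableType d) (P : probability T R).
Local Open Scope ereal_scope.

Lemma integral_layer_cake (a : R) : (0 <= a)%R ->
  \int[lebesgue_measure]_(t in setT) ((0 <= t < a)%R%:R)%:E = a%:E.
Proof.
move=> a0.
under eq_integral => t _.
  rewrite (_ : (0 <= t < a)%R%:R = \1_(`[0%R, a[ : set R) t); last first.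
    by rewrite indicE mem_setE in_itv.
  over.
rewrite integral_indic//= setIT lebesgue_measure_itv/= lte_fin.
case: ifPn => [_|]; first by rewrite oppr0 adde0.
by rewrite -leNgt => a0'; congr EFin; apply/eqP; rewrite eq_le a0 a0'.
Qed.

(* Extends a factorization from indicators to all f >= 0 through the layer
   cake formula f = \int_0^oo 1_{t < f} dt. *)
Lemma integral_factor_indic (Y X : T -> R) (c : \bar R) (f : R -> R) :
  measurable_fun setT Y -> (forall w, 0 <= Y w)%R ->
  measurable_fun setT X -> 0 <= c ->
  (forall A : set R, measurable A ->
    \int[P]_w (Y w * \1_A (X w))%:E = c * \int[P]_w (\1_A (X w))%:E) ->
  measurable_fun setT f -> (forall x, 0 <= f x)%R ->
  \int[P]_w (Y w * f (X w))%:E = c * \int[P]_w (f (X w))%:E.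
Proof.
move=> mY Y0 mX c0 YX mf f0.
pose mu := @lebesgue_measure R.
pose e (w : T) (t : R) : R := ((0 <= t < f (X w))%R)%:R.
have me : measurable_fun setT (fun z : T * measurableTypeR R => e z.1 z.2).
  apply: measurable_fun_natr_bool; apply: measurable_and.
    exact: measurable_fun_ler.
  apply: measurable_fun_ltr => //.
  by apply: measurableT_comp => //; apply: measurableT_comp => //;
     apply: measurableT_comp.
have mYe : measurable_fun setT (fun z : T * measurableTypeR R => (Y z.1 * e z.1
    z.2)%R).
  by apply: measurable_funM => //; apply: measurableT_comp.
have e0 w t : (0 <= e w t)%R by rewrite /e.
transitivity (\int[P]_w \int[mu]_t (Y w * e w t)%:E).
  apply: eq_integral => w _.
  under [RHS]eq_integral do rewrite EFinM.
  rewrite ge0_integralZl//; last 3 first.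
  - apply/measurable_EFinP.
    exact: (measurableT_comp me (pair1_measurable w)).
  - by move=> t _; rewrite lee_fin.
  - by rewrite lee_fin.
  by rewrite integral_layer_cake.
rewrite (fubini_tonelli (fun z : T * measurableTypeR R => (Y z.1 * e z.1
    z.2)%:E))//=; last 2 first.
- exact/measurable_EFinP.
- by move=> z; rewrite lee_fin mulr_ge0.
transitivity (\int[mu]_t (c * \int[P]_w (e w t)%:E)).
  apply: eq_integral => t _.
  (* At a fixed level [t] the slice is the indicator of a superlevel set of [f], to which the
     assumed factorization applies. *)
  pose A := [set x : R | (0 <= t < f x)%R].
  have mA : measurable A.
    have : measurable_fun setT (fun x => (0 <= t < f x)%R).
      by apply: measurable_and => //; apply: measurable_fun_ltr.
    by move=> /(_ measurableT [set true] _); rewrite setTI; apply.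
  have eA w : e w t = \1_A (X w).
    rewrite /e indicE (_ : (X w \in A) = (0 <= t < f (X w))%R)//.
    by apply/idP/idP; rewrite inE.
  under eq_integral do rewrite eA.
  under [in RHS]eq_integral do rewrite eA.
  exact: YX.
rewrite ge0_integralZl//; last 2 first.
- apply: (measurable_fun_fubini_tonelli_G (fun z : T * measurableTypeR R => (e
    z.1 z.2)%:E)) => //=.
    exact/measurable_EFinP.
  by move=> z; rewrite lee_fin.
- by move=> t _; apply: integral_ge0 => w _; rewrite lee_fin.
rewrite -(fubini_tonelli (fun z : T * measurableTypeR R => (e z.1 z.2)%:E))//=;
    last 2 first.
- exact/measurable_EFinP.
- by move=> z; rewrite lee_fin.
by congr (_ * _); apply: eq_integral => w _; rewrite integral_layer_cake.
Qed.

(** Independence is the case where every factor is an indicator. Induction on [k] then frees the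
    factors one at a time: those of index below [k] are arbitrary, the others are still indicators,
    and [integral_factor_indic] releases the factor of index [k]. *)
Lemma integral_prod_independent n (Xs : 'I_n -> {RV P >-> R})
    (f : 'I_n -> R -> R) :
  mutually_independent Xs ->
  (forall i, measurable_fun setT (f i)) -> (forall i x, 0 <= f i x)%R ->
  \int[P]_w (\prod_i f i (Xs i w))%:E = \prod_i \int[P]_w (f i (Xs i w))%:E.
Proof.
move=> indep.
suff H k : (k <= n)%N -> forall f : 'I_n -> R -> R,
    (forall i, measurable_fun setT (f i)) -> (forall i x, 0 <= f i x)%R ->
    (forall i : 'I_n, (k <= i)%N ->
       exists2 A : set R, measurable A & f i = \1_A) ->
    \int[P]_w (\prod_i f i (Xs i w))%:E =
    \prod_i \int[P]_w (f i (Xs i w))%:E.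
  move=> mf f0; apply: (H n) => // i; rewrite leqNgt ltn_ord//.
elim: k => [|k IH] kn {}f mf f0 fA.
  have /choice[A fAi] i : exists A : set R, measurable A /\ f i = \1_A.
    by have [A mA fiA] := fA i isT; exists A.
  have -> : (fun w => (\prod_i f i (Xs i w))%:E) =
      (fun w => (\1_(\bigcap_(i in [set` [set: 'I_n]%SET]) (Xs i @^-1` A i))
          w)%:E).
    apply/funext => w; congr EFin.
    have [wA|wA] := boolP (w \in \bigcap_(i in [set` [set: 'I_n]%SET]) (Xs i
        @^-1` A i)).
      rewrite indicE wA/=; apply: big1 => i _.
      have Ai : A i (Xs i w) by apply: (set_mem wA i); rewrite /= inE.
      by rewrite (fAi i).2 indicE mem_set.
    rewrite indicE (negbTE wA)/=.
    have [i wi] : exists i, ~ A i (Xs i w).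
      apply: contrapT => /forallNP h; move/negP: wA; apply.
      by rewrite inE => i _; apply: contrapT; exact: h.
    rewrite (bigD1 i)//= (fAi i).2 indicE memNset ?mul0r//.
  have mXA i : measurable (Xs i @^-1` A i).
    by rewrite -[X in measurable X]setTI; apply: measurable_funP => //; exact:
        (fAi i).1.
  transitivity (P (\bigcap_(i in [set` [set: 'I_n]%SET]) (Xs i @^-1` A i))).
    rewrite integral_indic//; first by congr (P _); exact: setIT.
    by apply: fin_bigcap_measurable.
  rewrite indep; last by move=> i _; exact: (fAi i).1.
  rewrite (eq_bigl xpredT); last by move=> i; rewrite inE.
  apply: eq_bigr => i _.
  rewrite (fAi i).2 (_ : (fun w => _) = (fun w => (\1_(Xs i @^-1` A i) w)%:E)).
    by rewrite integral_indic//; congr (P _); exact/esym/setIT.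
  by apply/funext => w; rewrite !indicE (_ : (Xs i w \in A i) = (w \in Xs i
      @^-1` A i)).
pose j := Ordinal kn.
rewrite [RHS](bigD1 j)//= muleC.
under eq_integral.
  move=> w _; rewrite (bigD1 j)//= mulrC.
  over.
apply: integral_factor_indic => //.
- under eq_fun do rewrite big_mkcond.
  apply: measurable_prod => i _.
  by case: (i == j) => //=; exact: measurableT_comp.
- by move=> w; apply: prodr_ge0.
- by apply: prode_ge0 => i _; apply: integral_ge0 => w _; rewrite lee_fin.
move=> A mA.
(* With factor [j] replaced by an indicator, only the factors of index below [k] are arbitrary, so
   the induction hypothesis applies to [g]. *)
pose g i := if i == j then \1_A : R -> R else f i.
have gj : g j = \1_A by rewrite /g eqxx.
have gf i : i != j -> g i = f i by rewrite /g => /negbTE ->.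
transitivity (\int[P]_w (\prod_i g i (Xs i w))%:E).
  apply: eq_integral => w _; rewrite [in RHS](bigD1 j)//= gj [in RHS]mulrC.
  by congr (_ * _)%:E; apply: eq_bigr => i ij; rewrite gf.
rewrite IH ?(ltnW kn)//.
- rewrite (bigD1 j)//= gj muleC; congr (_ * _).
  by apply: eq_bigr => i ij; apply: eq_integral => w _; rewrite gf.
- by move=> i; have [->|ij] := eqVneq i j; rewrite ?gj ?gf.
- by move=> i x; have [->|ij] := eqVneq i j; rewrite ?gj ?gf// indicE.
- move=> i ki; have [->|ij] := eqVneq i j; rewrite ?gj ?gf//; first by exists A.
  apply: fA; rewrite ltn_neqAle ki andbT.
  by apply: contra_neq ij => /esym ij; apply/val_inj.
Qed.

End independence.

(** * Distribution functions, quantiles and the area between two graphs *)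

Section distribution_functions.
Context {R : realType}.
Local Open Scope ereal_scope.
Implicit Types (F G : R -> R) (u x : R).
Local Notation mu := (@lebesgue_measure R).

(** Right continuity and the behaviour at infinity are phrased through order alone. The last two
    clauses say that F drops below every positive level and reaches every level below 1, which makes
    the quantile finite on ]0, 1[. *)
Definition distribution_function F : Prop :=
  [/\ {homo F : x y / (x <= y)%R},
      forall u x, (forall y, x < y -> u <= F y)%R -> (u <= F x)%R,
      forall u, (0 < u)%R -> exists x, (F x < u)%R &
      forall u, (u < 1)%R -> exists x, (u <= F x)%R].

(** The Galois connection. Right continuity passes from [u <= F y] for all [y > x] to [x] itself,
    which covers the case where the infimum equals [x]. *)
Lemma quantile_le F u x : distribution_function F ->
  (quantile (EFin \o F) u <= x%:E) = (u <= F x)%R.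
Proof.
move=> [ndF rcF _ _]; apply/idP/idP => [qx|uF]; last first.
  by apply: ereal_inf_lbound; exists x => //=; rewrite lee_fin.
apply: rcF => y xy.
have : quantile (EFin \o F) u < y%:E by apply: le_lt_trans qx _; rewrite
    lte_fin.
move=> /ereal_inf_lt[_ [z /= uz <-]]; rewrite lte_fin => zy.
by rewrite lee_fin in uz; apply: le_trans uz (ndF _ _ (ltW zy)).
Qed.

Lemma quantile_fin_num F u : distribution_function F -> (0 < u < 1)%R ->
  quantile (EFin \o F) u \is a fin_num.
Proof.
move=> dF /andP[u0 u1]; have [_ _ /(_ _ u0)[x xu] /(_ _ u1)[y yu]] := dF.
rewrite fin_real//; apply/andP; split.
  apply: (@lt_le_trans _ _ x%:E); first exact: ltNyr.
  by apply/ltW; rewrite ltNge quantile_le// -ltNge.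
by apply: (@le_lt_trans _ _ y%:E); [rewrite quantile_le|exact: ltry].
Qed.

(** The integrand is the indicator of the interval between [a] and [b]. This version integrates
    along abscissae; [integral_step_diff_ge] is its mirror image, used along levels. *)
Lemma integral_step_diff (a b : R) :
  \int[mu]_x (`|(a <= x)%R%:R - (b <= x)%R%:R|%R)%:E = (`|a - b|%R)%:E.
Proof.
wlog ab : a b / (a <= b)%R => [h|].
  have /orP[ab|ba] := le_total a b; first exact: h.
  by rewrite distrC -h//; apply: eq_integral => x _; rewrite distrC.
under eq_integral => x _.
  rewrite (_ : `|_|%R = \1_(`[a, b[ : set R) x); last first.
    rewrite indicE mem_setE in_itv/= ltNge.
    have [bx|bx] := leP b x; first by rewrite (le_trans ab bx) subrr normr0.
    by case: (a <= x)%R; rewrite subr0 ?normr1 ?normr0.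
  over.
rewrite integral_indic//= setIT lebesgue_measure_itv/= lte_fin.
rewrite distrC ger0_norm ?subr_ge0//.
case: ifPn => [_//|]; rewrite -leNgt => ba.
by congr EFin; apply/esym/eqP; rewrite subr_eq0 eq_le ab ba.
Qed.

Lemma integral_step_diff_ge (a b : R) :
  \int[mu]_u (`|(u <= a)%R%:R - (u <= b)%R%:R|%R)%:E = (`|a - b|%R)%:E.
Proof.
wlog ab : a b / (a <= b)%R => [h|].
  have /orP[ab|ba] := le_total a b; first exact: h.
  by rewrite distrC -h//; apply: eq_integral => x _; rewrite distrC.
under eq_integral => x _.
  rewrite (_ : `|_|%R = \1_(`]a, b] : set R) x); last first.
    rewrite indicE mem_setE in_itv/= ltNge.
    have [bx|bx] := leP x a; first by rewrite (le_trans bx ab) subrr normr0.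
    by case: (x <= b)%R; rewrite sub0r ?oppr0 ?normrN ?normr1 ?normr0.
  over.
rewrite integral_indic//= setIT lebesgue_measure_itv/= lte_fin.
rewrite distrC ger0_norm ?subr_ge0//.
case: ifPn => [_//|]; rewrite -leNgt => ba.
by congr EFin; apply/esym/eqP; rewrite subr_eq0 eq_le ab ba.
Qed.

Lemma quantile_diff F G u : distribution_function F -> distribution_function G
    ->
  (0 < u < 1)%R ->
  `|quantile (EFin \o F) u - quantile (EFin \o G) u| =
  \int[mu]_x (`|(u <= F x)%R%:R - (u <= G x)%R%:R|%R)%:E.
Proof.
move=> dF dG u01.
have /fineK qF := quantile_fin_num dF u01.
have /fineK qG := quantile_fin_num dG u01.
rewrite -qF -qG -EFinB abse_EFin -integral_step_diff.
by apply: eq_integral => x _; rewrite -!lee_fin qF qG !quantile_le.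
Qed.

Lemma measurable_distribution_function F : distribution_function F ->
  measurable_fun setT F.
Proof. by move=> [ndF _ _ _]; apply: nondecreasing_measurable. Qed.

(** The area between the two graphs, sliced along [u] and then along [x] by Tonelli. An inequality
    results because [u] is allowed to leave ]0, 1[ before the exchange. *)
Lemma integral_quantile_diff F G :
  distribution_function F -> distribution_function G ->
  \int[mu]_(u in `]0%R, 1%R[)
     `|quantile (EFin \o F) u - quantile (EFin \o G) u| <=
  \int[mu]_x (`|F x - G x|%R)%:E.
Proof.
move=> dF dG.
have mF := measurable_distribution_function dF.
have mG := measurable_distribution_function dG.
pose h (z : measurableTypeR R * measurableTypeR R) : R :=
  `|(z.1 <= F z.2)%R%:R - (z.1 <= G z.2)%R%:R|%R.
have mh : measurable_fun setT h.
  apply: measurableT_comp => //; apply: measurable_funB.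
    by apply: measurable_fun_natr_le => //; apply: measurableT_comp.
  by apply: measurable_fun_natr_le => //; apply: measurableT_comp.
have h0 z : 0 <= (h z)%:E by rewrite lee_fin /h.
have mEh : measurable_fun setT (EFin \o h) by exact/measurable_EFinP.
apply: (@le_trans _ _ (\int[mu]_(u in `]0%R, 1%R[) \int[mu]_x (h (u, x))%:E)).
  rewrite le_eqVlt; apply/orP; left; apply/eqP; apply: eq_integral => u.
  by rewrite inE/= in_itv/= => u01; rewrite quantile_diff.
apply: (@le_trans _ _ (\int[mu]_u \int[mu]_x (h (u, x))%:E)).
  apply: ge0_subset_integral => //.
    exact: (measurable_fun_fubini_tonelli_F (EFin \o h)).
  by move=> u _; apply: integral_ge0.
rewrite (fubini_tonelli (EFin \o h))//=.
rewrite le_eqVlt; apply/orP; left; apply/eqP; apply: eq_integral => x _.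
by rewrite -integral_step_diff_ge.
Qed.

(** The distribution function of the point mass at 0. Its quantile vanishes on ]0, 1[, so the area
    between F and this step controls the integral of |quantile F| and serves as a first absolute
    moment. *)
Lemma distribution_function_step : distribution_function (fun x => (0 <=
    x)%R%:R).
Proof.
split.
- by move=> x y xy; rewrite ler_nat; case: (leP 0%R x) => // x0; rewrite
    (le_trans x0 xy).
- move=> u x h; have [x0|x0] := leP 0%R x.
    by have := h (x + 1)%R; rewrite ltrDl addr_ge0//; apply.
  by have := h (x / 2)%R; rewrite (_ : (0 <= x / 2)%R = false); [apply;
      lra|apply/negbTE; rewrite -ltNge; lra].
- by move=> u u0; exists (-1)%R; rewrite lerNr oppr0 ler10.
- by move=> u u1; exists 0%R; rewrite lexx ltW.
Qed.

Lemma quantile_step u : (0 < u < 1)%R ->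
  quantile (EFin \o (fun x => (0 <= x)%R%:R)) u = 0.
Proof.
move=> /andP[u0 u1].
have H x : (quantile (EFin \o (fun x => (0 <= x)%R%:R)) u <= x%:E) = (0 <= x)%R.
  rewrite quantile_le; last exact: distribution_function_step.
  by case: (0 <= x)%R; [rewrite ltW|rewrite leNgt u0].
apply/eqP; rewrite eq_le H lexx/= leNgt; apply/negP.
set q := quantile _ u => q0.
have : exists2 x : R, (x < 0)%R & q <= x%:E.
  case: q q0 => [r|//|_]; first by rewrite lte_fin => r0; exists r.
  by exists (-1)%R; rewrite ?leNye// ltrN10.
by move=> [x x0]; rewrite H leNgt x0.
Qed.

(** By the Galois connection, the preimage of a ray above [x] is the set where [F z.1 x < z.2],
    which is jointly measurable. *)
Lemma measurable_fun_quantile d (T : measurableType d) (F : T -> R -> R) :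
  (forall w, distribution_function (F w)) ->
  (forall x, measurable_fun setT (F ^~ x)) ->
  measurable_fun setT
    (fun z : T * measurableTypeR R => quantile (EFin \o F z.1) z.2).
Proof.
move=> dF mF.
apply: (measurability _ (ErealGenOInfty.measurableE R)) => _ [_ [x ->] <-].
rewrite setTI.
have H z : (x%:E < quantile (EFin \o F z.1) z.2) = (F z.1 x < z.2)%R.
  by rewrite !ltNge quantile_le.
have -> : (fun z : T * measurableTypeR R => quantile (EFin \o F z.1) z.2) @^-1`
    `]x%:E, +oo[ = [set z | (F z.1 x < z.2)%R].
  by apply/seteqP; split => z /=; rewrite in_itv/= andbT H.
have : measurable_fun setT (fun z : T * measurableTypeR R => (F z.1 x < z.2)%R).
  by apply: measurable_fun_ltr => //; exact: (measurableT_comp (mF x)).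
by move=> /(_ measurableT [set true] _); rewrite setTI; apply.
Qed.

(** * Stability of the spectral integral under a bounded spectrum *)

Section spectral_integral.
Variables (K : R) (phi : R -> R).
Hypothesis K0 : (0 < K)%R.
Hypothesis mphi : measurable_fun (`[0%R, 1%R] : set R) phi.
Hypothesis phiK : forall u, (0 <= u <= 1)%R -> (0 <= phi u <= K)%R.

Lemma measurable_quantile F : distribution_function F ->
  measurable_fun setT (quantile (EFin \o F)).
Proof.
move=> dF.
have := @measurable_fun_quantile _ (measurableTypeR R) (fun=> F) (fun=> dF)
    (fun x => measurable_cst _).
move=> h.
exact: (measurableT_comp h (pair1_measurable (0%R : measurableTypeR R))).
Qed.

Lemma measurable_phi_oo : measurable_fun (`]0%R, 1%R[ : set R) phi.
Proof.
by apply: measurable_funS mphi => //; exact: subset_itv_oo_cc.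
Qed.

Lemma measurable_phi_quantile F : distribution_function F ->
  measurable_fun (`]0%R, 1%R[ : set R) (fun u => (phi u)%:E * quantile (EFin \o
      F) u).
Proof.
move=> dF; apply: emeasurable_funM.
  by apply/measurable_EFinP; exact: measurable_phi_oo.
by apply: measurable_funTS; exact: measurable_quantile.
Qed.

Lemma spectral_integral_oo F : distribution_function F ->
  spectral_integral phi (EFin \o F) =
  \int[mu]_(u in `]0%R, 1%R[) ((phi u)%:E * quantile (EFin \o F) u).
Proof. by move=> dF; rewrite /spectral_integral integral_itv_bndoo//; exact:
    measurable_phi_quantile. Qed.

Lemma integrable_phi_quantile F : distribution_function F ->
  \int[mu]_x (`|F x - (0 <= x)%R%:R|%R)%:E < +oo ->
  mu.-integrable (`]0%R, 1%R[ : set R)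
    (fun u => (phi u)%:E * quantile (EFin \o F) u).
Proof.
move=> dF Foo; apply/integrableP; split; first exact: measurable_phi_quantile.
apply: (@le_lt_trans _ _ (\int[mu]_(u in `]0%R, 1%R[)
    (K%:E * `|quantile (EFin \o F) u|))).
  apply: ge0_le_integral => //.
  - by apply: measurableT_comp => //; exact: measurable_phi_quantile.
  - apply: measurable_funeM; apply: measurableT_comp => //.
    by apply: measurable_funTS; exact: measurable_quantile.
  move=> u; rewrite /= in_itv/= => /andP[u0 u1].
  have /phiK/andP[p0 pK] : (0 <= u <= 1)%R by rewrite !ltW.
  by rewrite abseM lee_wpmul2r// abse_EFin lee_fin ger0_norm.
rewrite ge0_integralZl//; last 2 first.
- by apply: measurableT_comp => //; apply: measurable_funTS; exact:
    measurable_quantile.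
- by rewrite lee_fin ltW.
apply: lte_mul_pinfty; rewrite ?lee_fin ?(ltW K0)//.
apply: le_lt_trans Foo.
apply: le_trans (integral_quantile_diff dF distribution_function_step).
rewrite le_eqVlt; apply/orP; left; apply/eqP; apply: eq_integral => u.
by rewrite inE/= in_itv/= => u01; rewrite quantile_step// sube0.
Qed.

(** The two finiteness hypotheses are first-moment conditions: they make both integrands integrable,
    so that the integrals can be subtracted under one sign before [phi] is bounded by [K]. *)
Lemma spectral_integral_diff F G :
  distribution_function F -> distribution_function G ->
  \int[mu]_x (`|F x - (0 <= x)%R%:R|%R)%:E < +oo ->
  \int[mu]_x (`|G x - (0 <= x)%R%:R|%R)%:E < +oo ->
  `|spectral_integral phi (EFin \o F) - spectral_integral phi (EFin \o G)| <=
  K%:E * \int[mu]_x (`|F x - G x|%R)%:E.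
Proof.
move=> dF dG Foo Goo.
have iF := integrable_phi_quantile dF Foo.
have iG := integrable_phi_quantile dG Goo.
have mFG : measurable_fun (`]0%R, 1%R[ : set R)
    (fun u => quantile (EFin \o F) u - quantile (EFin \o G) u).
  by apply: emeasurable_funB; apply: measurable_funTS; exact:
      measurable_quantile.
rewrite !spectral_integral_oo// -integralB//.
apply: le_trans (le_abse_integral _ _ _) _ => //.
  by apply: emeasurable_funB; exact: measurable_phi_quantile.
apply: (@le_trans _ _ (\int[mu]_(u in `]0%R, 1%R[)
    (K%:E * `|quantile (EFin \o F) u - quantile (EFin \o G) u|))); last first.
  rewrite ge0_integralZl//; last 2 first.
  - exact: measurableT_comp.
  - by rewrite lee_fin ltW.
  by rewrite lee_wpmul2l ?lee_fin ?(ltW K0)// integral_quantile_diff.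
apply: ge0_le_integral => //.
- apply: measurableT_comp => //; apply: emeasurable_funB;
    exact: measurable_phi_quantile.
- by apply: measurable_funeM; apply: measurableT_comp.
move=> u; rewrite /= in_itv/= => u01.
have /phiK/andP[p0 pK] : (0 <= u <= 1)%R by case/andP : u01 => ? ?; rewrite
    !ltW.
rewrite -muleBr//; last first.
  by apply: fin_num_adde_defl; rewrite fin_numN quantile_fin_num.
by rewrite abseM lee_wpmul2r// abse_EFin lee_fin ger0_norm.
Qed.

End spectral_integral.

End distribution_functions.

(** * The empirical distribution function *)

Section empirical.
Context {R : realType}.
Implicit Types (u t : R).

Definition ecdf n (x : 'I_n -> R) t : R :=
  n%:R^-1 * \sum_(i < n) (x i <= t)%R%:R.

Lemma distribution_function_ecdf n (x : 'I_n -> R) : (0 < n)%N ->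
  distribution_function (ecdf x).
Proof.
move=> n0.
have n0R : 0 < (n%:R : R) by rewrite ltr0n.
have xmax i : `|x i| <= \sum_(j < n) `|x j|.
  by rewrite (bigD1 i)//= lerDl sumr_ge0.
split.
- move=> s t st; rewrite ler_wpM2l ?invr_ge0 ?ler0n// ler_sum// => i _.
  by rewrite ler_nat; case: (leP (x i) s) => // xs; rewrite (le_trans xs st).
- move=> u t h.
  (* Right continuity: the sample is finite, so for [y] close enough to [t] on the right no sample
     point lies in ]t, y]. *)
  have near_eq : \forall y \near t^'+, forall i, (x i <= y) = (x i <= t).
    apply: (@filter_forall _ _ (fun i y => (x i <= y) = (x i <= t))) => i.
    have [xt|tx] := leP (x i) t.
      near=> y; apply/idP; apply: le_trans xt _; apply/ltW.
      by near: y; exact: nbhs_right_gt.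
    near=> y; apply/negbTE; rewrite -ltNge.
    by near: y; exact: nbhs_right_lt.
  have [y /= [xy ty]] := filter_ex (filterI near_eq (nbhs_right_gt t)).
  apply: le_trans (h _ ty) _.
  by rewrite /ecdf; under eq_bigr do rewrite xy.
- move=> u u0; exists (- (1 + \sum_(j < n) `|x j|)).
  rewrite /ecdf big1 ?mulr0// => i _.
  rewrite leNgt (_ : _ < x i)//.
  by have := xmax i; have := ler_norm (- x i); rewrite normrN; lra.
- move=> u u1; exists (\sum_(j < n) `|x j|).
  rewrite /ecdf (eq_bigr (fun=> 1)) => [|i _]; last first.
    by rewrite (le_trans (ler_norm _) (xmax i)).
  by rewrite sumr_const card_ord mulVf ?gt_eqF// ltW.
Unshelve. all: by end_near. Qed.

Lemma empirical_cdfE n (x : 'I_n -> R) : empirical_cdf x = EFin \o ecdf x.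
Proof. by []. Qed.

(** The difference is an average of differences of steps, one for each sample point, and the step at
    [x i] lies at distance |x i| from the step at 0. *)
Lemma ecdf_step_le n (x : 'I_n -> R) : (0 < n)%N ->
  (\int[lebesgue_measure]_t (`|ecdf x t - (0 <= t)%R%:R|%R)%:E <=
   (n%:R^-1 * \sum_(i < n) `|x i|)%:E)%E.
Proof.
move=> n0.
have n0R : 0 < (n%:R : R) by rewrite ltr0n.
have [ndF _ _ _] := distribution_function_ecdf x n0.
have mstep i : measurable_fun setT
    (fun t : R => (`|(x i <= t)%R%:R - (0 <= t)%R%:R : R|%R)%:E).
  apply/measurable_EFinP; apply: measurableT_comp => //.
  by apply: measurable_funB; exact: measurable_fun_natr_le.
apply: (@le_trans _ _ (\int[lebesgue_measure]_t
    ((n%:R^-1)%:E * \sum_(i < n) (`|(x i <= t)%R%:R - (0 <= t)%R%:R|%R)%:E))%E).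
  apply: ge0_le_integral => //.
  - apply/measurable_EFinP; apply: measurableT_comp => //; apply:
      measurable_funB.
      exact: nondecreasing_measurable.
    exact: measurable_fun_natr_le.
  - apply: measurable_funeM; apply: emeasurable_sum => i; exact: mstep.
  move=> t _; rewrite sumEFin -EFinM lee_fin.
  rewrite (_ : _ - _ = n%:R^-1 * \sum_(i < n) ((x i <= t)%R%:R - (0 <=
      t)%R%:R)).
    by rewrite normrM ger0_norm ?invr_ge0 ?ler0n// ler_wpM2l ?invr_ge0 ?ler0n//
        ler_norm_sum.
  rewrite sumrB sumr_const card_ord mulrBr; congr (_ - _).
  by rewrite -[X in _ = _ * X]mulr_natr mulrCA mulVf ?gt_eqF// mulr1.
rewrite ge0_integralZl//; last 2 first.
- by apply: emeasurable_sum => i; exact: mstep.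
- by move=> t _; apply: sume_ge0.
rewrite ge0_integral_sum//.
rewrite EFinM -sumEFin lee_wpmul2l ?lee_fin ?invr_ge0 ?ler0n//.
apply: lee_sum => i _; rewrite integral_step_diff subr0//.
Qed.

End empirical.

(** * The distribution function of X and its tails *)

Section cdf.
Context {R : realType} d (T : measurableType d) (P : probability T R).
Variable X : {RV P >-> R}.

Definition rcdf (t : R) : R := fine (cdf X t).

Lemma rcdfE : cdf X = EFin \o rcdf.
Proof. by apply/funext => t; rewrite /rcdf /= fineK// fin_num_measure. Qed.

Lemma rcdf_ge0 t : 0 <= rcdf t.
Proof. by rewrite fine_ge0// cdf_ge0. Qed.

Lemma rcdf_le1 t : rcdf t <= 1.
Proof. by rewrite -lee_fin -[leLHS]/((EFin \o rcdf) t) -rcdfE cdf_le1. Qed.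

Lemma distribution_function_rcdf : distribution_function rcdf.
Proof.
have E t : (rcdf t)%:E = cdf X t by rewrite rcdfE.
split.
- by move=> s t st; rewrite -lee_fin !E cdf_nondecreasing.
- move=> u t h; rewrite leNgt; apply/negP => tu.
  have := @cdf_right_continuous _ _ _ P X t.
  rewrite -E => /fine_cvg/cvgr_lt/(_ _ tu) => near_lt.
  have [y [yu ty]] : exists y, rcdf y < u /\ t < y.
    by apply: (@filter_ex _ (t^'+)); apply: filterI; [exact: near_lt|exact:
        nbhs_right_gt].
  by have := le_lt_trans (h _ ty) yu; rewrite ltxx.
- move=> u u0; have := @cvg_cdfNy0 _ _ _ P X.
  by move=> /fine_cvg/cvgr_lt/(_ _ u0); exact: filter_ex.
- move=> u u0; have := @cvg_cdfy1 _ _ _ P X.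
  by move=> /fine_cvg/cvgr_ge/(_ _ u0); exact: filter_ex.
Qed.

(** Markov's inequality for the exponential moment. The event is left general so as to serve both
    tails. *)
Lemma exp_moment_tail (beta gamma top x : R) (A : set T) :
  0 <= beta -> 0 <= gamma -> measurable A -> (forall w, A w -> `|x| <= `|X w|)
      ->
  (\int[P]_w (expR (gamma * `|X w| `^ beta))%:E <= top%:E)%E ->
  (P A <= (top * expR (- (gamma * `|x| `^ beta)))%:E)%E.
Proof.
move=> b0 g0 mA Ax Xtop.
have mX : measurable_fun setT (fun w => expR (gamma * `|X w| `^ beta)).
  apply: measurableT_comp => //; apply: measurable_funM => //.
  apply: (measurableT_comp (measurable_powR _)).
  exact: measurableT_comp.
set e := expR (- _).
have e0 : 0 <= e by exact: expR_ge0.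
rewrite -(setIT A) -integral_indic//.
apply: (@le_trans _ _ (\int[P]_w (e%:E * (expR (gamma * `|X w| `^
    beta))%:E))%E).
  apply: ge0_le_integral => //.
  - exact/measurable_EFinP.
  - by apply/measurable_EFinP; apply: measurable_funM.
  move=> w _; rewrite -EFinM lee_fin -expRD indicE.
  have [/set_mem wA|_] := boolP (w \in A); last exact: expR_ge0.
  rewrite -[leLHS]expR0 ler_expR addrC subr_ge0 ler_wpM2l//.
  by apply: ge0_ler_powR; rewrite ?nnegrE// Ax.
rewrite ge0_integralZl//; last exact/measurable_EFinP.
by rewrite mulrC EFinM lee_wpmul2l.
Qed.

(** The left side is P(X > x) for [x >= 0] and P(X <= x) for [x < 0]; either event forces |X| >=
    |x|. *)
Lemma rcdf_step_tail (beta gamma top x : R) :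
  0 <= beta -> 0 <= gamma ->
  (\int[P]_w (expR (gamma * `|X w| `^ beta))%:E <= top%:E)%E ->
  `|rcdf x - (0 <= x)%R%:R| <= top * expR (- (gamma * `|x| `^ beta)).
Proof.
move=> b0 g0 Xtop.
have E t : (rcdf t)%:E = cdf X t by rewrite rcdfE.
have mA : measurable (X @^-1` `]-oo, x]).
  by rewrite -[Y in measurable Y]setTI; apply: measurable_funP.
rewrite -lee_fin; have [x0|x0] := leP 0 x.
  have -> : (`|rcdf x - 1%:R|)%:E = P (~` (X @^-1` `]-oo, x])).
    rewrite probability_setC// -[P (_ @^-1` _)]/(cdf X x) -E -EFinB.
    by rewrite distrC ger0_norm// subr_ge0 rcdf_le1.
  apply: exp_moment_tail => //; first exact: measurableC.
  move=> w /=; rewrite in_itv/= => /negP; rewrite -ltNge => xX.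
  by rewrite !ger0_norm// ltW// (le_lt_trans x0).
rewrite subr0 ger0_norm ?rcdf_ge0// E.
apply: exp_moment_tail => // w /=; rewrite in_itv/= => Xx.
by rewrite !ler0_norm ?lerN2// ltW// (le_lt_trans Xx).
Qed.

Lemma rcdf_variance_le x : rcdf x * (1 - rcdf x) <= `|rcdf x - (0 <= x)%R%:R|.
Proof.
have F0 := rcdf_ge0 x; have F1 := rcdf_le1 x.
case: (leP 0 x) => _.
  by rewrite distrC ger0_norm ?subr_ge0// ler_piMl// subr_ge0.
by rewrite subr0 ger0_norm// ler_piMr// gerBl.
Qed.

End cdf.

(** * Moment generating functions for an i.i.d. sample *)

Section iid.
Context {R : realType}.
Context {d} {T : measurableType d} {P : probability T R}.
Context {d'} {T' : measurableType d'} {P' : probability T' R}.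
Variables (n : nat) (Xs : 'I_n -> {RV P >-> R}) (X : {RV P' >-> R}).
Hypothesis iid : iid_sample Xs X.
Local Notation mu := (@lebesgue_measure R).
Local Notation F := (rcdf X).
Local Notation Fn w := (ecdf (fun i => Xs i w)).

Lemma integral_same_distribution i (f : R -> R) :
  measurable_fun setT f -> (forall x, 0 <= f x) ->
  (\int[P]_w (f (Xs i w))%:E = \int[P']_w (f (X w))%:E)%E.
Proof.
move=> mf f0.
have mEf : measurable_fun setT (EFin \o f) by exact/measurable_EFinP.
have Ef0 x : (0 <= (EFin \o f) x)%E by rewrite lee_fin.
rewrite -(ge0_integral_distribution (Xs i) mEf Ef0).
rewrite -(ge0_integral_distribution X mEf Ef0).
by apply: eq_measure_integral => A mA _; exact: iid.2.
Qed.

Lemma integral_bernoulli_rcdf (a b x : R) :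
  (\int[P']_w (if (X w <= x)%R then a else b)%:E =
   (F x * a + (1 - F x) * b)%:E)%E.
Proof.
pose A := X @^-1` `]-oo, x].
have mA : measurable A.
  by rewrite -[Y in measurable Y]setTI; apply: measurable_funP.
have PA : P' A = (F x)%:E by rewrite /rcdf fineK// fin_num_measure.
have PAc : P' (~` A) = (1 - F x)%:E by rewrite probability_setC// PA -EFinB.
transitivity (\int[P']_w ((\1_A w * a)%:E + (\1_(~` A) w * b)%:E))%E.
  apply: eq_integral => w _; rewrite -EFinD !indicE; congr EFin.
  have -> : (w \in A) = (X w <= x).
    by apply/idP/idP; rewrite inE /A /= in_itv.
  have -> : (w \in ~` A) = ~~ (X w <= x).
    by apply/idP/idP; rewrite inE /A /= in_itv/= => /negP.
  by case: ifP; rewrite !(mul1r, mul0r, addr0, add0r).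
have mAi (B : set T') (c : R) : measurable B ->
    P'.-integrable setT (fun w => (\1_B w * c)%:E).
  move=> mB; under eq_fun do rewrite EFinM.
  apply: integrableZr => //; exact: integrable_indic.
rewrite integralD//; [|exact: mAi|by apply: mAi; exact: measurableC].
under eq_integral do rewrite EFinM.
rewrite integralZr//; last exact: integrable_indic.
under [X in (_ + X)%E]eq_integral do rewrite EFinM.
rewrite integralZr//; last by apply: integrable_indic => //; exact: measurableC.
have iE (B : set T') : measurable B -> (\int[P']_w (\1_B w)%:E = P' B)%E.
  by move=> mB; rewrite integral_indic// setIT.
by rewrite !iE ?PA ?PAc//; exact: measurableC.
Qed.

(** Independence turns the expectation into an n-th power of the Bernoulli bound, which
    [1 + y <= expR y] puts in exponential form. *)
Lemma mgf_sum_le (t x : R) :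
  (\int[P]_w (expR (t * \sum_(i < n) ((Xs i w <= x)%R%:R - F x)))%:E <=
   (expR (n%:R * (t ^+ 2 * expR `|t| * (F x * (1 - F x)))))%:E)%E.
Proof.
pose f (v : R) : R := expR (t * ((v <= x)%R%:R - F x)).
have mf : measurable_fun setT f.
  apply: measurableT_comp => //; apply: measurable_funM => //.
  by apply: measurable_funB => //; exact: measurable_fun_natr_le.
have -> : (fun w => (expR (t * \sum_(i < n) ((Xs i w <= x)%R%:R - F x)))%:E) =
    (fun w => (\prod_(i < n) f (Xs i w))%:E).
  by apply/funext => w; rewrite mulr_sumr expR_sum.
rewrite (integral_prod_independent (f := fun=> f) iid.1)//; last first.
  by move=> _ v; exact: expR_ge0.
have Ef i : (\int[P]_w (f (Xs i w))%:E)%E = (F x * expR (t * (1 - F x)) +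
    (1 - F x) * expR (t * (0 - F x)))%:E.
  rewrite integral_same_distribution//; last by move=> v; exact: expR_ge0.
  rewrite -integral_bernoulli_rcdf; apply: eq_integral => w _.
  by rewrite /f; case: (X w <= x).
under eq_bigr do rewrite Ef.
rewrite prodEFin lee_fin prodr_const card_ord [n%:R * _]mulrC expRM_natr.
have F01 : 0 <= F x <= 1 by rewrite rcdf_ge0 rcdf_le1.
apply: lerXn2r; rewrite ?nnegrE ?expR_ge0//.
  by rewrite addr_ge0// mulr_ge0 ?expR_ge0 ?subr_ge0//; case/andP: F01.
apply: le_trans (centered_bernoulli_mgf t F01) _; exact: expR_ge1Dx.
Qed.

Hypothesis n0 : (0 < n)%N.

(** The factor 2 comes from bounding exp |s| by exp s + exp (- s), each term being controlled by
    [mgf_sum_le]. *)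
Lemma mgf_ecdf_diff_le (t x : R) : 0 <= t ->
  (\int[P]_w (expR (n%:R * t * `|Fn w x - F x|))%:E <=
   (2 * expR (n%:R * (t ^+ 2 * expR t * (F x * (1 - F x)))))%:E)%E.
Proof.
move=> t0.
have n0R : 0 < (n%:R : R) by rewrite ltr0n.
pose S w : R := \sum_(i < n) ((Xs i w <= x)%R%:R - F x).
have mS : measurable_fun setT S.
  by apply: measurable_sum => i; apply: measurable_funB => //;
    exact: measurable_fun_natr_le.
have SE w : n%:R * t * `|Fn w x - F x| = `|t * S w|.
  rewrite normrM (ger0_norm t0) -mulrA mulrCA; congr (_ * _).
  rewrite -[X in X * _](ger0_norm (ltW n0R)) -normrM /S sumrB sumr_const
      card_ord.
  by rewrite -[F x *+ n]mulr_natl mulrBr /ecdf mulrA mulfV ?gt_eqF// mul1r.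
apply: (@le_trans _ _ (\int[P]_w ((expR (t * S w))%:E + (expR (- t * S
    w))%:E))%E).
  apply: ge0_le_integral => //.
  - apply/measurable_EFinP; apply: measurableT_comp => //.
    under eq_fun do rewrite SE.
    by apply: measurableT_comp => //; exact: measurable_funM.
  - by apply: emeasurable_funD; apply/measurable_EFinP;
      apply: measurableT_comp => //; exact: measurable_funM.
  move=> w _; rewrite SE -EFinD lee_fin mulNr.
  have [s0|s0] := leP 0 (t * S w).
    by rewrite ger0_norm// lerDl expR_ge0.
  by rewrite ltr0_norm// lerDr expR_ge0.
rewrite ge0_integralD//; last 2 first.
- by apply/measurable_EFinP; apply: measurableT_comp => //; exact:
    measurable_funM.
- by apply/measurable_EFinP; apply: measurableT_comp => //; exact:
    measurable_funM.
rewrite mulr_natl mulr2n EFinD.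
have := mgf_sum_le t x; have := mgf_sum_le (- t) x.
by rewrite sqrrN normrN (ger0_norm t0) => h1 h2; exact: leeD.
Qed.

Lemma measurable_ecdf : measurable_fun setT
  (fun z : T * measurableTypeR R => Fn z.1 z.2).
Proof.
apply: measurable_funM => //; apply: measurable_sum => i.
apply: measurable_fun_natr_le => //.
exact: (measurableT_comp (measurable_funPT (Xs i))).
Qed.

End iid.

(** * Gaussian deviation bound for the Wasserstein distance *)

Section deviation.
Context {R : realType}.
Variables (beta gamma top kappa c0 C0 : R).
Hypotheses (beta1 : 1 < beta) (gamma0 : 0 < gamma) (top0 : 0 < top).
Hypotheses (kappa0 : 0 < kappa) (c00 : 0 < c0) (C00 : 0 < C0).
Local Notation mu := (@lebesgue_measure R).
Hypothesis kappaE : (\int[mu]_x ((weight beta x)^-1)%:E = kappa%:E)%E.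
Hypothesis tail : forall x q, q <= top * expR (- (gamma * `|x| `^ beta)) ->
  weight beta x ^+ 2 * expR (c0 * weight beta x) * q <= C0.

Let beta0 : 0 <= beta. Proof. by rewrite ltW// (lt_trans _ beta1). Qed.

Let w0 x : 0 < weight beta x. Proof. exact: weight_gt0. Qed.

Let iw0 x : 0 <= (weight beta x)^-1. Proof. by rewrite invr_ge0 ltW. Qed.

Let mw : measurable_fun setT (weight beta).
Proof. by apply: continuous_measurable_fun; exact: continuous_weight. Qed.

Let miw : measurable_fun setT (fun x => (weight beta x)^-1).
Proof.
apply: continuous_measurable_fun => x.
by apply: cvgV; [rewrite gt_eqF|exact: continuous_weight].
Qed.

(* Jensen's inequality for exp and the finite measure dx / weight, in tangent
   form so that the integral of g may be infinite. *)
Lemma expR_integral_le (g : R -> R) (lambda delta : R) :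
  measurable_fun setT g -> (forall x, 0 <= g x) -> 0 < lambda -> 0 <= delta ->
  (delta%:E < \int[mu]_x (g x)%:E)%E ->
  ((kappa * expR (lambda * delta))%:E <=
   \int[mu]_x (expR (lambda * kappa * weight beta x * g x) / weight beta
       x)%:E)%E.
Proof.
move=> mg g0 l0 d0 dg.
set e := expR (lambda * delta).
have e0 : 0 < e by exact: expR_gt0.
have mf : measurable_fun setT
    (fun x => expR (lambda * kappa * weight beta x * g x) / weight beta x).
  apply: measurable_funM => //; apply: measurableT_comp => //.
  by apply: measurable_funM => //; apply: measurable_funM.
have f0 x : 0 <= expR (lambda * kappa * weight beta x * g x) / weight beta x.
  by rewrite mulr_ge0 ?expR_ge0.
(* The tangent to exp at [lambda * delta], divided by the weight. Its negative term is moved to the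
   right so that both integrands are nonnegative. *)
have h : (\int[mu]_x ((e / weight beta x)%:E + (e * lambda * kappa * g x)%:E) <=
    \int[mu]_x ((expR (lambda * kappa * weight beta x * g x) / weight beta
        x)%:E +
                (e * (lambda * delta) / weight beta x)%:E))%E.
  apply: ge0_le_integral => //.
  - move=> x _; rewrite -EFinD lee_fin addr_ge0// mulr_ge0 ?(ltW e0)//.
    by rewrite !mulr_ge0// ltW.
  - by apply: emeasurable_funD; apply/measurable_EFinP; apply: measurable_funM.
  - by apply: emeasurable_funD; apply/measurable_EFinP => //; apply:
      measurable_funM.
  move=> x _; rewrite -!EFinD lee_fin -mulrDl ler_pdivlMr// mulrDl mulfVK
      ?gt_eqF//.
  have := expR_ge_tangent (lambda * kappa * weight beta x * g x) (lambda *
      delta).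
  rewrite -/e; lra.
move: h.
have iE c : 0 <= c -> (\int[mu]_x (c / weight beta x)%:E = (c * kappa)%:E)%E.
  move=> cge0; under eq_integral do rewrite EFinM.
  rewrite ge0_integralZl//; first by rewrite kappaE.
    exact/measurable_EFinP.
  by move=> x _; rewrite lee_fin.
rewrite ge0_integralD//; last 4 first.
- by move=> x _; rewrite lee_fin mulr_ge0// ltW.
- by apply/measurable_EFinP; apply: measurable_funM.
- by move=> x _; rewrite lee_fin !mulr_ge0// ltW.
- by apply/measurable_EFinP; apply: measurable_funM.
rewrite ge0_integralD//; last 4 first.
- by move=> x _; rewrite lee_fin.
- exact/measurable_EFinP.
- by move=> x _; rewrite lee_fin !mulr_ge0// ltW.
- by apply/measurable_EFinP; apply: measurable_funM.
have ld0 : 0 <= lambda * delta by rewrite mulr_ge0// ltW.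
rewrite !iE ?mulr_ge0 ?(ltW e0) ?(ltW l0)//.
under [X in (_ + X <= _)%E]eq_integral do rewrite EFinM.
have elk0 : 0 < e * lambda * kappa by rewrite !mulr_gt0.
rewrite ge0_integralZl//; last 3 first.
- exact/measurable_EFinP.
- by move=> x _; rewrite lee_fin.
- by rewrite lee_fin ltW.
have dg' : ((e * lambda * kappa)%:E * delta%:E <=
    (e * lambda * kappa)%:E * \int[mu]_x (g x)%:E)%E.
  by apply: lee_wpmul2l; [rewrite lee_fin ltW|exact: ltW].
move=> /(le_trans (leeD2l _ dg')).
rewrite -EFinM -EFinD => {}dg'.
have fin_c : (e * (lambda * delta) * kappa)%:E \is a fin_num by [].
rewrite -(leeD2rE _ _ fin_c).
apply: le_trans dg'; rewrite -EFinD lee_fin le_eqVlt; apply/orP; left.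
by apply/eqP; ring.
Qed.

Context {d} {T : measurableType d} {P : probability T R}.
Context {d'} {T' : measurableType d'} {P' : probability T' R}.
Variables (n : nat) (Xs : 'I_n -> {RV P >-> R}) (X : {RV P' >-> R}).
Hypothesis iid : iid_sample Xs X.
Hypothesis n0 : (0 < n)%N.
Hypothesis Xtop : (\int[P']_w (expR (gamma * `|X w| `^ beta))%:E <= top%:E)%E.
Local Notation F := (rcdf X).
Local Notation Fn w := (ecdf (fun i => Xs i w)).

Definition wasserstein w : \bar R := (\int[mu]_x (`|Fn w x - F x|)%:E)%E.

(** The first bound keeps the exponent [t] below [c0 * weight], within reach of [tail]. The second
    makes the quadratic term of the final exponent at most half of the linear one. *)
Definition small_rate : R := Num.min (c0 / kappa) (2 * kappa ^+ 2 * C0)^-1.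

Lemma small_rate_gt0 : 0 < small_rate.
Proof.
rewrite lt_min divr_gt0//= invr_gt0.
by rewrite !mulr_gt0// exprn_gt0.
Qed.

Let n0R : 0 < (n%:R : R). Proof. by rewrite ltr0n. Qed.

Let mF : measurable_fun setT F.
Proof. by apply: measurable_distribution_function; exact:
    distribution_function_rcdf. Qed.

Let mFn w : measurable_fun setT (Fn w).
Proof. by apply: measurable_distribution_function; exact:
    distribution_function_ecdf. Qed.

Let mG w : measurable_fun setT (fun x => `|Fn w x - F x|).
Proof. by apply: measurableT_comp => //; exact: measurable_funB. Qed.

(** Chernoff's method with [lambda] proportional to n delta: the double integral of [I] is at least
    kappa exp(lambda delta) P(A) by Jensen and, by Tonelli, at most kappa B. *)
Lemma small_deviation (A : set T) (delta : R) : measurable A ->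
  0 < delta <= 1 -> (forall w, A w -> (delta%:E < wasserstein w)%E) ->
  (P A <= (2 * expR (- (small_rate / 2) * n%:R * delta ^+ 2))%:E)%E.
Proof.
move=> mA /andP[d0 d1] AW.
set eta := small_rate.
have eta0 : 0 < eta := small_rate_gt0.
have etac : eta * kappa <= c0 by rewrite -ler_pdivlMr// /eta/small_rate ge_min
    lexx.
have etaC : eta * kappa ^+ 2 * C0 <= 1 / 2.
  have : eta <= (2 * kappa ^+ 2 * C0)^-1 by rewrite /eta/small_rate ge_min lexx
      orbT.
  have k0 : 0 < 2 * kappa ^+ 2 * C0 by rewrite !mulr_gt0// exprn_gt0.
  rewrite -(ler_pM2r k0) mulVf ?gt_eqF//; lra.
pose lambda := eta * n%:R * delta.
have l0 : 0 < lambda by rewrite !mulr_gt0.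
pose I (z : T * measurableTypeR R) : R :=
  expR (lambda * kappa * weight beta z.2 * `|Fn z.1 z.2 - F z.2|) / weight beta
      z.2.
have mI : measurable_fun setT I.
  apply: measurable_funM; last exact: (measurableT_comp miw).
  apply: measurableT_comp => //; apply: measurable_funM.
    apply: measurable_funM => //; exact: (measurableT_comp mw).
  apply: measurableT_comp => //; apply: measurable_funB.
    exact: measurable_ecdf.
  exact: (measurableT_comp mF).
have mEI : measurable_fun setT (EFin \o I) by exact/measurable_EFinP.
have I0 z : (0 <= (EFin \o I) z)%E by rewrite lee_fin mulr_ge0 ?expR_ge0.
pose B := 2 * expR (n%:R * (eta ^+ 2 * delta ^+ 2 * kappa ^+ 2 * C0)).
have IB x : (\int[P]_w (I (w, x))%:E <= (B / weight beta x)%:E)%E.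
  (* Chosen so that [lambda * kappa * weight = n * t]; the hypothesis [delta <= 1] is what yields
     [t <= c0 * weight]. *)
  pose t := eta * delta * kappa * weight beta x.
  have t0 : 0 <= t by rewrite !mulr_ge0// ltW.
  have v0 : 0 <= F x * (1 - F x) by rewrite mulr_ge0 ?rcdf_ge0 ?subr_ge0
      ?rcdf_le1.
  under eq_integral.
    move=> w _.
    rewrite /I/= (_ : lambda * _ * _ = n%:R * t); last by rewrite /lambda/t;
        ring.
    rewrite EFinM; over.
  rewrite ge0_integralZr//; last 2 first.
  - apply/measurable_EFinP; apply: measurableT_comp => //.
    apply: measurable_funM => //; apply: measurableT_comp => //.
    apply: measurable_funB => //.
    exact: (measurableT_comp (measurable_ecdf Xs) (pair2_measurable (x :
        measurableTypeR R))).
  - by rewrite lee_fin.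
  rewrite [leRHS]EFinM lee_wpmul2r ?lee_fin//.
  apply: le_trans (mgf_ecdf_diff_le iid n0 x t0) _.
  rewrite lee_fin ler_wpM2l// ler_expR ler_wpM2l ?ler0n//.
  have q := tail (rcdf_step_tail x beta0 (ltW gamma0) Xtop).
  have tc : t <= c0 * weight beta x.
    rewrite ler_wpM2r ?(ltW (w0 _))//; apply: le_trans etac.
    by rewrite mulrAC ler_piMr// mulr_ge0// ltW.
  apply: (@le_trans _ _ (eta ^+ 2 * delta ^+ 2 * kappa ^+ 2 *
     (weight beta x ^+ 2 * expR (c0 * weight beta x) * (F x * (1 - F x))))).
    rewrite [leRHS](_ : _ = t ^+ 2 * expR (c0 * weight beta x) * (F x * (1 - F
        x))).
      by rewrite ler_wpM2r// ler_wpM2l ?sqr_ge0// ler_expR.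
    by rewrite /t; ring.
  apply: ler_wpM2l; first by rewrite !mulr_ge0// ltW.
  apply: le_trans q.
  by rewrite ler_wpM2l ?rcdf_variance_le// mulr_ge0 ?expR_ge0 ?sqr_ge0.
have key : ((kappa * expR (lambda * delta))%:E * P A <= (B * kappa)%:E)%E.
  rewrite -(setIT A) -integral_indic// -ge0_integralZl//; last 2 first.
  - exact/measurable_EFinP.
  - by rewrite lee_fin mulr_ge0 ?expR_ge0// ltW.
  apply: (@le_trans _ _ (\int[P]_w \int[mu]_x (EFin \o I) (w, x))%E).
    apply: ge0_le_integral => //.
    - by move=> w _; rewrite -EFinM lee_fin !mulr_ge0 ?expR_ge0// ltW.
    - by apply: measurable_funeM; exact/measurable_EFinP.
    - exact: (measurable_fun_fubini_tonelli_F (EFin \o I)).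
    move=> w _; rewrite indicE; have [/set_mem wA|_] := boolP (w \in A).
      by rewrite mule1; apply: expR_integral_le => //; [exact: mG|exact:
          ltW|exact: AW].
    by rewrite mule0; apply: integral_ge0.
  rewrite (fubini_tonelli (EFin \o I))//.
  apply: (@le_trans _ _ (\int[mu]_x (B%:E * ((weight beta x)^-1)%:E))%E).
    apply: ge0_le_integral => //.
    - by move=> x _; apply: integral_ge0.
    - exact: (measurable_fun_fubini_tonelli_G (EFin \o I)).
    - by apply: measurable_funeM; exact/measurable_EFinP.
    by move=> x _; rewrite -EFinM; exact: IB.
  rewrite ge0_integralZl//; first by rewrite kappaE.
  - exact/measurable_EFinP.
  - by move=> x _; rewrite lee_fin.
  - by rewrite lee_fin mulr_ge0 ?expR_ge0.
move: key; rewrite -(@fineK _ (P A)) ?fin_num_measure// -EFinM !lee_fin.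
set p := fine (P A) => key.
have {}key : expR (lambda * delta) * p <= B.
  by rewrite -(ler_pM2r kappa0) mulrC mulrA.
have ld : expR (- (lambda * delta)) * expR (lambda * delta) = 1.
  by rewrite mulrC expRxMexpNx_1.
apply: (@le_trans _ _ (expR (- (lambda * delta)) * B)).
  by rewrite -[p]mul1r -ld -mulrA ler_wpM2l ?expR_ge0.
rewrite /B mulrCA ler_wpM2l// -expRD ler_expR.
(* By [etaC] the last factor is at most -1/2. *)
rewrite (_ : - (lambda * delta) + _ =
    eta * n%:R * delta ^+ 2 * (eta * kappa ^+ 2 * C0 - 1)).
  rewrite (_ : - (eta / 2) * n%:R * delta ^+ 2 = eta * n%:R * delta ^+ 2 * (-
      (1 / 2))).
    rewrite ler_wpM2l ?mulr_ge0 ?sqr_ge0 ?(ltW eta0)//; lra.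
  by field.
by rewrite /lambda; ring.
Qed.

End deviation.

(** * Measurability of the empirical spectral risk *)

Section measurability_of_the_estimate.
Context {R : realType} {d} {T : measurableType d}.
Variables (phi : R -> R).
Hypothesis mphi : measurable_fun (`[0%R, 1%R] : set R) phi.
Local Notation mu := (@lebesgue_measure R).

(** [phi] is measurable on [0, 1] only, hence it is extended by zero outside ]0, 1[. Splitting into
    positive and negative parts reduces the claim to the measurability of parameter integrals of
    nonnegative functions. *)
Lemma measurable_spectral_integral (G : T -> R -> R) :
  (forall w, distribution_function (G w)) ->
  (forall x, measurable_fun setT (G ^~ x)) ->
  measurable_fun setT (fun w => spectral_integral phi (EFin \o G w)).
Proof.
move=> dG mG.
pose D : set R := `]0%R, 1%R[%classic.
pose f (z : T * measurableTypeR R) : \bar R :=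
  (((phi \_ D) z.2)%:E * quantile (EFin \o G z.1) z.2)%E.
have mf : measurable_fun setT f.
  apply: emeasurable_funM; last exact: measurable_fun_quantile.
  apply/measurable_EFinP.
  have mphiD : measurable_fun setT (phi \_ D).
    apply: (measurable_restrictT _ _).1; first exact: measurable_itv.
    exact: measurable_phi_oo.
  exact: (measurableT_comp mphiD).
have -> : (fun w => spectral_integral phi (EFin \o G w)) =
    (fun w => \int[mu]_u f^\+%E (w, u) - \int[mu]_u f^\-%E (w, u))%E.
  apply/funext => w; rewrite spectral_integral_oo// integral_mkcond integralE.
  have fE : (fun u => (phi u)%:E * quantile (EFin \o G w) u)%E \_ D =
      (fun u => f (w, u)).
    by apply/funext => u; rewrite /f /patch/=; case: ifP => //; rewrite mul0e.
  rewrite fE; congr (_ - _)%E; apply: eq_integral => u _.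
    by rewrite !funeposE.
  by rewrite !funenegE.
apply: emeasurable_funB.
  by apply: (measurable_fun_fubini_tonelli_F f^\+%E) => //; exact:
      measurable_funepos.
by apply: (measurable_fun_fubini_tonelli_F f^\-%E) => //; exact:
    measurable_funeneg.
Qed.

End measurability_of_the_estimate.

(** * Deviation bound for large thresholds *)

Section large_deviation.
Context {R : realType}.
Variables (beta gamma top kappa c0 C0 : R).
Hypotheses (beta1 : 1 < beta) (gamma0 : 0 < gamma) (top0 : 0 < top).
Hypotheses (kappa0 : 0 < kappa) (c00 : 0 < c0) (C00 : 0 < C0).
Local Notation mu := (@lebesgue_measure R).
Hypothesis kappaE : (\int[mu]_x ((weight beta x)^-1)%:E = kappa%:E)%E.
Hypothesis tail : forall x q, q <= top * expR (- (gamma * `|x| `^ beta)) ->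
  weight beta x ^+ 2 * expR (c0 * weight beta x) * q <= C0.

Let beta0 : 0 < beta. Proof. by rewrite (lt_trans _ beta1). Qed.

Context {d'} {T' : measurableType d'} {P' : probability T' R}.
Variable X : {RV P' >-> R}.
Hypothesis Xtop : (\int[P']_w (expR (gamma * `|X w| `^ beta))%:E <= top%:E)%E.

(** As the weight and the exponential are both at least 1, [tail] bounds the integrand by
    [C0 / weight]. *)
Lemma integral_rcdf_step_le :
  (\int[mu]_x (`|rcdf X x - (0 <= x)%R%:R|)%:E <= (C0 * kappa)%:E)%E.
Proof.
have mF : measurable_fun setT (rcdf X).
  by apply: measurable_distribution_function; exact: distribution_function_rcdf.
have miw : measurable_fun setT (fun x => (weight beta x)^-1).
  apply: continuous_measurable_fun => x.
  by apply: cvgV; [rewrite gt_eqF// weight_gt0|exact: continuous_weight].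
apply: (@le_trans _ _ (\int[mu]_x (C0%:E * ((weight beta x)^-1)%:E))%E).
  apply: ge0_le_integral => //.
  - apply/measurable_EFinP; apply: measurableT_comp => //.
    by apply: measurable_funB => //; exact: measurable_fun_natr_le.
  - by apply: measurable_funeM; exact/measurable_EFinP.
  move=> x _; rewrite -EFinM lee_fin ler_pdivlMr ?weight_gt0//.
  apply: le_trans (tail (rcdf_step_tail x (ltW beta0) (ltW gamma0) Xtop)).
  rewrite mulrC ler_wpM2r//.
  have w1 : 1 <= weight beta x by apply: weight_ge1; exact: ltW.
  have e1 : 1 <= expR (c0 * weight beta x).
    by rewrite -expR0 ler_expR mulr_ge0// ltW// weight_gt0.
  nra.
rewrite ge0_integralZl//; first by rewrite kappaE.
- exact/measurable_EFinP.
- by move=> x _; rewrite lee_fin invr_ge0 ltW// weight_gt0.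
- by rewrite lee_fin ltW.
Qed.

Context {d} {T : measurableType d} {P : probability T R}.
Variables (n : nat) (Xs : 'I_n -> {RV P >-> R}).
Hypothesis iid : iid_sample Xs X.
Hypothesis n0 : (0 < n)%N.

Let n0R : 0 < (n%:R : R). Proof. by rewrite ltr0n. Qed.

(** Triangle inequality through the step at 0: the two sides contribute the first absolute moments
    of the sample and of X. *)
Lemma wasserstein_le_mean w :
  (wasserstein Xs X w <= (n%:R^-1 * \sum_(i < n) `|Xs i w| + C0 * kappa)%:E)%E.
Proof.
have mF : measurable_fun setT (rcdf X).
  by apply: measurable_distribution_function; exact: distribution_function_rcdf.
have mFn : measurable_fun setT (ecdf (fun i => Xs i w)).
  by apply: measurable_distribution_function; exact: distribution_function_ecdf.
have mH : measurable_fun setT (fun x : R => (0 <= x)%R%:R : R).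
  exact: measurable_fun_natr_le.
apply: le_trans; last first.
  rewrite EFinD; apply: leeD; last exact: integral_rcdf_step_le.
  exact: (ecdf_step_le (fun i => Xs i w) n0).
rewrite -ge0_integralD//; last 2 first.
- by apply/measurable_EFinP; apply: measurableT_comp => //; exact:
    measurable_funB.
- by apply/measurable_EFinP; apply: measurableT_comp => //; exact:
    measurable_funB.
apply: ge0_le_integral => //.
- by apply/measurable_EFinP; apply: measurableT_comp => //; exact:
    measurable_funB.
- by apply: emeasurable_funD; apply/measurable_EFinP; apply: measurableT_comp
    => //;
    exact: measurable_funB.
by move=> x _; rewrite -EFinD lee_fin (le_trans (ler_distD (0 <= x)%R%:R _
    _))// lerD2l distrC.
Qed.

(** Jensen's inequality for the power: the tangents at [s] are summed, and their slope is
    nonnegative, so the mean may be replaced by its lower bound [s]. *)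
Lemma sum_powR_ge (x : 'I_n -> R) (s : R) : 0 <= s ->
  (forall i, 0 <= x i) -> s <= n%:R^-1 * \sum_(i < n) x i ->
  n%:R * s `^ beta <= \sum_(i < n) x i `^ beta.
Proof.
move=> s0 x0 sx.
have {}sx : n%:R * s <= \sum_(i < n) x i.
  by rewrite -ler_pdivlMl.
apply: (@le_trans _ _ (\sum_(i < n)
    (beta * s `^ (beta - 1) * x i - (beta - 1) * s `^ beta))); last first.
  by apply: ler_sum => i _; exact: powR_ge_tangent.
rewrite sumrB sumr_const card_ord -mulr_sumr -[X in _ <= _ - X]mulr_natl.
have ss : s `^ beta = s * s `^ (beta - 1).
  have [->|sn0] := eqVneq s 0; first by rewrite mul0r powR0// gt_eqF.
  have := @powRD R s 1 (beta - 1); rewrite sn0 implybT powRr1// => <-//.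
  by rewrite addrC subrK.
have c0' : 0 <= beta * s `^ (beta - 1) by rewrite mulr_ge0 ?powR_ge0// ltW.
have := ler_wpM2l c0' sx; rewrite ss.
set q := s `^ (beta - 1); lra.
Qed.

(** The lower bound on [delta] leaves a sample mean of |X_i| above [delta / 2] on [A]. Convexity
    then bounds the sum of |X_i|^beta from below, and Markov's inequality with independence gives
    one factor [top] per sample point. *)
Lemma large_deviation (A : set T) (delta : R) : measurable A ->
  2 * (C0 * kappa) <= delta -> 0 <= delta ->
  (forall w, A w -> (delta%:E < wasserstein Xs X w)%E) ->
  (P A <= (expR (- (gamma * (n%:R * (delta / 2) `^ beta))) * top ^+ n)%:E)%E.
Proof.
move=> mA md d0 AW.
set e := expR _.
pose f (v : R) := expR (gamma * `|v| `^ beta).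
have mf : measurable_fun setT f.
  apply: measurableT_comp => //; apply: measurable_funM => //.
  apply: (measurableT_comp (measurable_powR _)).
  exact: normr_measurable.
have f0 v : 0 <= f v by exact: expR_ge0.
have mprod : measurable_fun setT (fun w => \prod_(i < n) f (Xs i w)).
  by apply: measurable_prod => i _; exact: measurableT_comp.
rewrite -(setIT A) -integral_indic//.
apply: (@le_trans _ _ (\int[P]_w (e%:E * (\prod_(i < n) f (Xs i w))%:E))%E).
  apply: ge0_le_integral => //.
  - exact/measurable_EFinP.
  - by apply: measurable_funeM; exact/measurable_EFinP.
  move=> w _; rewrite -EFinM lee_fin indicE.
  have p0 : 0 <= \prod_(i < n) f (Xs i w) by apply: prodr_ge0.
  have [/set_mem wA|_] := boolP (w \in A); last by rewrite mulr_ge0 ?expR_ge0.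
  rewrite /f -expR_sum /e -expRD -[leLHS]expR0 ler_expR -mulr_sumr addrC.
  rewrite subr_ge0 ler_wpM2l ?(ltW gamma0)//.
  apply: sum_powR_ge => //; first by rewrite divr_ge0.
  have := lt_le_trans (AW _ wA) (wasserstein_le_mean w).
  rewrite lte_fin; lra.
rewrite ge0_integralZl//; last 3 first.
- exact/measurable_EFinP.
- by move=> w _; rewrite lee_fin prodr_ge0.
- by rewrite lee_fin expR_ge0.
rewrite EFinM lee_wpmul2l ?lee_fin ?expR_ge0//.
rewrite (integral_prod_independent (f := fun=> f) iid.1)//.
under eq_bigr do rewrite (integral_same_distribution iid)//.
have [r Er] : exists r : R, (\int[P']_w (f (X w))%:E = r%:E)%E.
  exists (fine (\int[P']_w (f (X w))%:E)%E); rewrite fineK// ge0_fin_numE.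
    by apply: le_lt_trans Xtop _; exact: ltry.
  by apply: integral_ge0 => w _; rewrite lee_fin.
have r0 : 0 <= r.
  by rewrite -lee_fin -Er; apply: integral_ge0 => w _; rewrite lee_fin.
have rtop : r <= top by rewrite -lee_fin -Er.
under eq_bigr do rewrite Er.
by rewrite prodEFin lee_fin prodr_const card_ord lerXn2r// nnegrE ltW.
Qed.

End large_deviation.

(** * Reduction to the Wasserstein distance and choice of the constants *)

Lemma wasserstein_bound (R : realType) d (T : measurableType d)
    (P : probability T R) d' (T' : measurableType d') (P' : probability T' R)
    (n : nat) (Xs : 'I_n -> {RV P >-> R}) (X : {RV P' >-> R})
    (K : R) (phi : R -> R) (w : T) :
  0 < K -> measurable_fun (`[0, 1] : set R) phi ->
  (forall u, 0 <= u <= 1 -> 0 <= phi u <= K) -> (0 < n)%N ->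
  (\int[lebesgue_measure]_x (`|rcdf X x - (0 <= x)%R%:R|)%:E < +oo)%E ->
  (`|empirical_spectral_risk phi (fun i => Xs i w) - spectral_risk phi X| <=
   K%:E * wasserstein Xs X w)%E.
Proof.
move=> K0 mphi phiK n0 Foo.
rewrite /empirical_spectral_risk /spectral_risk empirical_cdfE rcdfE.
apply: spectral_integral_diff => //.
- exact: distribution_function_ecdf.
- exact: distribution_function_rcdf.
- by apply: le_lt_trans (ecdf_step_le _ n0) _; exact: ltry.
Qed.

Theorem corollary30 (R : realType) (beta gamma top : R)
    (beta_gt1 : 1 < beta) (gamma_gt0 : 0 < gamma) (top_gt0 : 0 < top) :
  exists c1 c2 c3 : R, [/\ 0 < c1, 0 < c2, 0 < c3 &
  forall (d' : measure_display) (T' : measurableType d')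
    (P' : probability T' R) (X : {RV P' >-> R}),
  ('E_P' [fun w => expR (gamma * `|X w| `^ beta)%R] < top%:E)%E ->
  forall (K : R) (phi : R -> R), 0 < K ->
  measurable_fun (`[0, 1] : set R) phi ->
  (forall u, 0 <= u <= 1 -> 0 <= phi u <= K) ->
  forall (d : measure_display) (T : measurableType d) (P : probability T R)
    (n : nat) (Xs : 'I_n -> {RV P >-> R}), (1 <= n)%N ->
  iid_sample Xs X ->
  forall eps : R, 0 < eps ->
  (P [set w | eps%:E < `| empirical_spectral_risk phi (fun i => Xs i w)
                          - spectral_risk phi X |]
   <= (c1 * (expR (- c2 * n%:R * (eps / K) ^+ 2) * (eps <= K)%R%:R
             + expR (- c3 * n%:R * (eps / K) `^ beta) * (K < eps)%R%:R))%:E)%E].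
Proof.
have beta_gt0 : 0 < beta by rewrite (lt_trans _ beta_gt1).
have [kappa [kappa0 kappaE]] := integral_inv_weight beta_gt1.
have [c0 [C0 [c00 C00 tail]]] := weight_exp_tail beta_gt0 gamma_gt0 top_gt0.
pose c2 := small_rate kappa c0 C0 / 2.
have c20 : 0 < c2 by rewrite divr_gt0// small_rate_gt0.
(* The rate of [large_deviation] once the 2 is taken out of (delta / 2)^beta. *)
pose g := gamma / 2 `^ beta.
have g0 : 0 < g by rewrite divr_gt0// powR_gt0.
(* Beyond D the deviation bound of the sum of |X_i| absorbs both the mean
   and the factor top ^ n. *)
pose D := Num.max 1 (Num.max (2 * (C0 * kappa)) (2 * top / g)).
have D1 : 1 <= D by rewrite /D le_max lexx.
have DC : 2 * (C0 * kappa) <= D by rewrite /D !le_max lexx !orbT.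
have Dg : 2 * top / g <= D by rewrite /D !le_max lexx !orbT.
have Db0 : 0 < D `^ beta by rewrite powR_gt0// (lt_le_trans _ D1).
(* The first entry makes the Gaussian bound at threshold 1 sufficient up to [D]; the second leaves
   half of the rate [g] to absorb [top ^+ n]. *)
pose c3 := Num.min (c2 / D `^ beta) (g / 2).
have c30 : 0 < c3 by rewrite lt_min; apply/andP; split; apply: divr_gt0.
(* The value 2 is the prefactor in [small_deviation]; the bound for large thresholds has prefactor
   1. *)
exists 2, c2, c3; split => // d' T' P' X Xtop K phi K0 mphi phiK d T P n Xs n0
    iid eps eps0.
have {}Xtop : (\int[P']_w (expR (gamma * `|X w| `^ beta))%:E <= top%:E)%E.
  by move: Xtop; rewrite unlock => /ltW.
have Foo : (\int[lebesgue_measure]_x (`|rcdf X x - (0 <= x)%R%:R|)%:E < +oo)%E.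
  apply: le_lt_trans (integral_rcdf_step_le beta_gt1 gamma_gt0 c00 C00
    kappaE tail Xtop) _; exact: ltry.
set A := [set w | _].
have mA : measurable A.
  have mm : measurable_fun setT (fun w =>
      `|empirical_spectral_risk phi (fun i => Xs i w) - spectral_risk phi X|%E).
    apply: measurableT_comp => //; apply: emeasurable_funB => //.
    apply: (measurable_spectral_integral mphi (G := fun w => ecdf (fun i => Xs
        i w))).
      by move=> w; exact: distribution_function_ecdf.
    move=> x; apply: measurable_funM => //; apply: measurable_sum => i.
    exact: measurable_fun_natr_le.
  by have := emeasurable_fun_o_infty measurableT mm eps%:E; rewrite setTI.
set delta := eps / K.
have d0 : 0 < delta by rewrite divr_gt0.
have AW w : A w -> (delta%:E < wasserstein Xs X w)%E.
  rewrite /A /= => h.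
  have := lt_le_trans h (wasserstein_bound Xs w K0 mphi phiK n0 Foo).
  by rewrite /delta mulrC EFinM lte_pdivrMl.
have n0R : 0 < (n%:R : R) by rewrite ltr0n.
have small := small_deviation beta_gt1 gamma_gt0 kappa0 c00 C00 kappaE tail iid
  n0 Xtop mA.
have [epsK|Keps] := leP eps K.
  rewrite mulr1 mulr0 addr0; apply: small => //.
  by rewrite d0 ler_pdivrMr// mul1r.
rewrite mulr0 add0r mulr1.
have d1 : 1 < delta by rewrite ltr_pdivlMr// mul1r.
(* For [delta] between 1 and [D], the event lies inside that of threshold 1. *)
have [dD|Dd] := leP delta D.
  apply: le_trans (small 1 _ _) _; first by rewrite lexx ltr01.
    by move=> w /AW; apply: lt_trans; rewrite lte_fin.
  rewrite lee_fin ler_wpM2l// ler_expR expr1n mulr1 !mulNr lerN2.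
  rewrite mulrAC ler_wpM2r ?ler0n//.
  apply: (@le_trans _ _ (c3 * D `^ beta)).
    rewrite ler_wpM2l ?(ltW c30)//.
    by apply: ge0_ler_powR; rewrite ?nnegrE// ltW// (lt_le_trans _ D1).
  by rewrite -ler_pdivlMr// /c3 ge_min lexx.
apply: le_trans (large_deviation beta_gt1 gamma_gt0 top_gt0 c00 C00 kappaE tail
  Xtop iid n0 mA _ (ltW d0) AW) _; first by rewrite (le_trans DC)// ltW.
have topn : top ^+ n <= expR (n%:R * top).
  rewrite mulrC expRM_natr lerXn2r ?nnegrE ?expR_ge0// ?(ltW top_gt0)//.
  by apply: le_trans (expR_ge1Dx _); rewrite lerDr.
(* Since [delta > 1] and [beta > 1], the linear lower bound on [delta] built into [D] becomes a
   bound of [top] by half of g delta^beta. *)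
have db : delta <= delta `^ beta.
  by rewrite -{1}[delta]powRr1 ?(ltW d0)// ler_powR// ltW.
have topd : top <= g / 2 * delta `^ beta.
  have : 2 * top / g <= delta by rewrite (le_trans Dg)// ltW.
  rewrite ler_pdivrMr// => h; nra.
rewrite lee_fin.
apply: (@le_trans _ _ (expR (- c3 * n%:R * delta `^ beta))); last first.
  by rewrite ler_peMl ?expR_ge0// ler1n.
apply: (@le_trans _ _ (expR (- (gamma * (n%:R * (delta / 2) `^ beta))) * expR
    (n%:R * top))).
  by rewrite ler_wpM2l ?expR_ge0.
rewrite -expRD ler_expR.
have -> : gamma * (n%:R * (delta / 2) `^ beta) = n%:R * (g * delta `^ beta).
  rewrite powRM ?(ltW d0)// -(powR_inv1 (_ : 0 <= 2))// -powRrM mulN1r powRN.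
  by rewrite /g; field; rewrite gt_eqF// powR_gt0.
have c3g : c3 <= g / 2 by rewrite /c3 ge_min lexx orbT.
have c3db : c3 * delta `^ beta <= g / 2 * delta `^ beta.
  by rewrite ler_wpM2r ?powR_ge0.
have : n%:R * (top + c3 * delta `^ beta) <= n%:R * (g * delta `^ beta).
  rewrite ler_wpM2l ?ler0n//; lra.
lra.
Qed.
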